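(* Let $V=[n]$ and let $\chi\colon V^2\to C$ be a coloring that assigns loops colors different from those of non-loops and respects converse equivalence. Then walk refinement stabilizes in $2n$ iterations: the smallest $m$ with $\chi_{\mathcal{W}}^m\equiv\chi_{\mathcal{W}}^{m+1}$ satisfies $m\le 2n$.
   Context: $\chi$ respects converse equivalence if $\chi(u_1,v_1)=\chi(u_2,v_2)$ implies $\chi(v_1,u_1)=\chi(v_2,u_2)$. With $\overline{\chi}(v_1,\dots,v_m)=(\chi(v_1,v_2),\dots,\chi(v_{m-1},v_m))$, the $k$-walk refinement ($k\ge2$) is $\chi_{\mathcal{W}[k]}(u,v)=\{\!\{\overline\chi(u,w_1,\dots,w_{k-1},v): w_i\in V\}\!\}$; the walk refinement $\chi_{\mathcal{W}}$ is $\chi_{\mathcal{W}[k]}$ for the smallest $k$ for which it induces the finest partition of $V^2$ among all $k$-walk refinements. $\chi_{\mathcal{W}}^m$ denotes $m$-fold iterated application (each time applied to the current coloring). $\chi\equiv\chi'$ means both colorings induce the same partition of $V^2$. *)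

(* Defs.v *)
From mathcomp Require Import all_boot.
From mathcomp Require Import finmap multiset.
From mathcomp Require Import boolp classical_sets.

Set Implicit Arguments.
Unset Strict Implicit.
Unset Printing Implicit Defensive.

(* The set of colors is part of the coloring, because every refinement step
   changes it. *)
Record coloring (V : finType) := Coloring {
  color : choiceType;
  color_of :> V -> V -> color
}.

Section Colorings.
Variable V : finType.
Implicit Types chi : coloring V.

Definition separates_loops chi :=
  forall u v w : V, v <> w -> chi u u <> chi v w.

Definition respects_converse chi :=
  forall u1 v1 u2 v2 : V, chi u1 v1 = chi u2 v2 -> chi v1 u1 = chi v2 u2.

Definition finer chi chi' :=
  forall u1 v1 u2 v2 : V, chi u1 v1 = chi u2 v2 -> chi' u1 v1 = chi' u2 v2.

Definition same_partition chi chi' := finer chi chi' /\ finer chi' chi.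

(* The colors chi w1 w2, chi w2 w3, ... along the walk u, w, v. *)
Definition walk_colors chi (u : V) (w : seq V) (v : V) : seq (color chi) :=
  pairmap chi u (rcons w v).

Definition kwalk_refinement (k : nat) chi : coloring V :=
  @Coloring V {mset (seq (color chi))}%mset
    (fun u v => seq_mset [seq walk_colors chi u (val w) v
                         | w <- enum {: k.-1.-tuple V}]).

Definition finest_length chi (k : nat) :=
  2 <= k /\
  forall j, 2 <= j -> finer (kwalk_refinement k chi) (kwalk_refinement j chi).

(* The least k with [finest_length chi k]. The default 2 is only taken when no
   k-walk refinement is finest. This cannot happen if chi separates loops: one
   can pad a walk with a loop at its end, so the partitions get finer as k
   grows, and V * V has finitely many partitions. *)
Definition walk_length chi : nat :=
  xget 2 [set k | finest_length chi k /\
                  forall j, finest_length chi j -> k <= j]%classic.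

Definition walk_refinement chi : coloring V :=
  kwalk_refinement (walk_length chi) chi.

Definition walk_refinement_iter (m : nat) chi : coloring V :=
  iter m walk_refinement chi.

Definition stable_at chi (m : nat) :=
  same_partition (walk_refinement_iter m chi) (walk_refinement_iter m.+1 chi).

End Colorings.

(* Main.v *)
Require Import Defs.
From mathcomp Require Import all_boot all_algebra all_field.
From mathcomp Require Import boolp zify finmap multiset.
From mathcomp Require classical_sets.

(* Two pairs get the same color under walk refinement iff they agree as
   positions of every matrix in the complex algebra A spanned by the products
   of matrices that are constant on the color classes: the entries of such
   products are sums over walks. As the coloring respects converse equivalence
   and separates loops, A is closed under adjoints and unital. Iterating the
   refinement therefore yields an increasing chain of *-algebras of n x n
   matrices, and the coloring is stable as soon as the chain repeats.

   For such an algebra let r(A) be the largest number of pairwise orthogonal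
   nonzero projections in A, and A' its commutant. If A is contained in B, then
   r(A) <= r(B) and r(A') >= r(B'), and A = B if both are equalities. Hence
   r(A) + (n - r(A')), a number between 1 and 2n, increases strictly along a
   strict chain. *)

Set Implicit Arguments.
Unset Strict Implicit.
Unset Printing Implicit Defensive.

Import GRing.Theory Num.Theory.
Local Open Scope ring_scope.
Local Open Scope sesquilinear_scope.

(** * Star-algebras of complex matrices and their orthogonal families of projections *)

Section StarAlgebras.
Variables (C : numClosedFieldType) (n : nat).
Implicit Types (A B : 'M[C]_n -> Prop) (x y p : 'M[C]_n).

Record star_algebra A : Prop := StarAlgebra {
  star_algebra1 : A 1%:M;
  star_algebraD : forall x y, A x -> A y -> A (x + y);
  star_algebraZ : forall c x, A x -> A (c *: x);
  star_algebraM : forall x y, A x -> A y -> A (x *m y);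
  star_algebraC : forall x, A x -> A (x^t*)
}.

Definition commutant A : 'M[C]_n -> Prop :=
  fun x => forall y, A y -> x *m y = y *m x.

Definition projection_in A p := [/\ A p, p^t* = p & p *m p = p].

Definition orthogonal_family A k (e : 'I_k -> 'M[C]_n) :=
  (forall i, projection_in A (e i) /\ e i != 0) /\
  (forall i j, i != j -> e i *m e j = 0).

(** The cut-off at [n] loses nothing: by [orthogonal_family_size] no family is larger. *)
Definition projection_rank A : nat :=
  \max_(k < n.+1 | `[< exists e : 'I_k -> 'M_n, orthogonal_family A e >]) k.

(** Maximality concerns the number [k] alone, so it passes to every other family of the same size in
    [A]. *)
Definition maximal_family A k (e : 'I_k -> 'M[C]_n) :=
  orthogonal_family A e /\ forall e', ~ @orthogonal_family A k.+1 e'.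

Lemma adjmxM x y : (x *m y)^t* = y^t* *m x^t*.
Proof. by rewrite trmx_mul map_mxM. Qed.

Lemma adjmxD x y : (x + y)^t* = x^t* + y^t*.
Proof. by rewrite linearD /= map_mxD. Qed.

Lemma adjmxZ c x : (c *: x)^t* = (c^*)%C *: x^t*.
Proof. by rewrite linearZ /= map_mxZ. Qed.

Lemma adjmx1 : (1%:M : 'M[C]_n)^t* = 1%:M.
Proof. by rewrite trmx1 map_mx1. Qed.

Lemma adjmx0 : (0 : 'M[C]_n)^t* = 0.
Proof. by rewrite trmx0 map_mx0. Qed.

Lemma adjmxB x y : (x - y)^t* = x^t* - y^t*.
Proof. by rewrite linearB /= map_mxB. Qed.

Lemma adjmx_sum (I : finType) (P : pred I) (F : I -> 'M[C]_n) :
  (\sum_(i | P i) F i)^t* = \sum_(i | P i) (F i)^t*.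
Proof. exact: (big_morph (fun x => x^t*) adjmxD adjmx0). Qed.

(** The diagonal entries of the product are the squared norms of the columns of [x]. *)
Lemma adjmx_mul_eq0 x : x^t* *m x = 0 -> x = 0.
Proof.
move=> x0; apply/matrixP => i j; rewrite [RHS]mxE.
have /eqP := congr1 (fun M : 'M[C]_n => M j j) x0.
rewrite !mxE psumr_eq0 => [/allP /(_ i)|k _]; last first.
  by rewrite !mxE mulrC mul_conjC_ge0.
by rewrite mem_index_enum !mxE mulrC mul_conjC_eq0 => /(_ isT)/eqP.
Qed.

Lemma star_algebra0 A : star_algebra A -> A 0.
Proof.
by move=> sA; rewrite -(scale0r 1%:M); apply: star_algebraZ (star_algebra1 sA).
Qed.

Lemma star_algebraB A x y : star_algebra A -> A x -> A y -> A (x - y).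
Proof.
move=> sA Ax Ay; rewrite -scaleN1r.
by apply: star_algebraD => //; apply: star_algebraZ.
Qed.

Lemma star_algebra_sum A (I : Type) (r : seq I) (P : pred I) F :
  star_algebra A -> (forall i, P i -> A (F i)) -> A (\sum_(i <- r | P i) F i).
Proof.
move=> sA AF; apply: big_ind => //; first exact: star_algebra0.
exact: star_algebraD.
Qed.

Lemma commutant_star_algebra A : star_algebra A -> star_algebra (commutant A).
Proof.
move=> sA; split => [y _|x y Cx Cy z Az|c x Cx z Az|x y Cx Cy z Az|x Cx z Az].
- by rewrite mul1mx mulmx1.
- by rewrite mulmxDl mulmxDr Cx ?Cy.
- by rewrite -scalemxAl -scalemxAr Cx.
- by rewrite -mulmxA Cy // !mulmxA Cx.
by rewrite -[z in LHS]trmxCK -adjmxM -Cx ?adjmxM ?trmxCK //; apply: star_algebraC.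
Qed.

Lemma commutantS A B : (forall x, A x -> B x) ->
  forall x, commutant B x -> commutant A x.
Proof. by move=> sAB x Cx y /sAB/Cx. Qed.

Lemma orthogonal_familyS A B k (e : 'I_k -> _) : (forall x, A x -> B x) ->
  orthogonal_family A e -> orthogonal_family B e.
Proof.
by move=> sAB [eA eO]; split=> // i; have [[/sAB]] := eA i.
Qed.

(** A nonzero row chosen from each [e i] gives [k] independent vectors: multiplying a linear
    relation by [e j] on the right leaves only its [j]-th term. *)
Lemma orthogonal_family_size A k (e : 'I_k -> _) :
  orthogonal_family A e -> (k <= n)%N.
Proof.
case=> eA eO.
have /choice [r er] (i : 'I_k) : exists r, row r (e i) != 0.
  have [_ ei0] := eA i; apply/existsP; apply: contraNT ei0.
  rewrite negb_exists => /forallP r0; apply/eqP/row_matrixP => s.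
  by rewrite row0; apply/eqP/negbNE/r0.
pose X := \matrix_(i < k) row (r i) (e i).
suff /eqP <- : row_free X by exact: rank_leq_col.
rewrite -kermx_eq0; apply/eqP/row_matrixP => s; rewrite row0.
set u := row s _.
have uX : u *m X = 0 by apply/sub_kermxP; apply: row_sub.
apply/rowP => j; rewrite [RHS]mxE.
have Xe : X *m e j = delta_mx j 0 *m row (r j) (e j).
  apply/row_matrixP => i; rewrite row_mul rowK -row_mul [RHS]row_mul.
  have [->|nij] := eqVneq i j.
    have [[_ _ ->] _] := eA j.
    rewrite [row j (delta_mx _ _)](_ : _ = 1%:M) ?mul1mx //.
    by apply/rowP=> t; rewrite !mxE !ord1 eqxx.
  rewrite eO // row0 [row i (delta_mx _ _)](_ : _ = 0) ?mul0mx //.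
  by apply/rowP=> t; rewrite !mxE (negPf nij).
have /eqP : u *m X *m e j = 0 by rewrite uX mul0mx.
rewrite -mulmxA Xe mulmxA -colE.
rewrite [col j u](_ : _ = (u 0 j)%:M); last first.
  by apply/rowP=> t; rewrite !mxE !ord1 eqxx mulr1n.
by rewrite mul_scalar_mx scaler_eq0 (negPf (er j)) orbF => /eqP.
Qed.

Lemma projection_orthC p q : p^t* = p -> q^t* = q -> p *m q = 0 -> q *m p = 0.
Proof. by move=> hp hq pq; rewrite -hp -hq -adjmxM pq adjmx0. Qed.

Lemma orthogonal_family_add A k (e : 'I_k -> _) p :
    orthogonal_family A e -> projection_in A p -> p != 0 ->
    (forall i, e i *m p = 0) ->
  exists e', @orthogonal_family A k.+1 e'.
Proof.
move=> [eA eO] Ap p0 ep.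
exists (fun i => if unlift ord0 i is Some j then e j else p); split=> [i|i j].
  by case: unliftP => [j|] _.
case: unliftP => [i'|] ->; case: unliftP => [j'|] -> //.
- by rewrite (inj_eq (@lift_inj _ _)) => /eO.
- move=> _; have [[_ h _] _] := eA j'; case: Ap => _ h' _.
  exact: projection_orthC.
Qed.

Lemma projection_rank_maximal A :
  exists e, @maximal_family A (projection_rank A) e.
Proof.
set P := fun k : 'I_n.+1 => `[< exists e : 'I_k -> 'M_n, orthogonal_family A e >].
have P0 : (0 < #|P|)%N.
  apply/card_gt0P; exists ord0; apply/asboolP.
  by exists (fun _ => 0); split=> -[].
have [k Pk maxk] := eq_bigmax_cond (fun k : 'I_n.+1 => k : nat) P0.
have rk : projection_rank A = k by rewrite -maxk; apply: eq_bigl.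
have /asboolP [e eA] : P k by [].
rewrite rk; exists e; split=> // e' e'A.
have lek : (k.+1 < n.+1)%N by rewrite ltnS; apply: orthogonal_family_size e'A.
have : (Ordinal lek <= projection_rank A)%N.
  by apply: (@leq_bigmax_cond _ P (fun k : 'I_n.+1 => k : nat)); apply/asboolP; exists e'.
by rewrite rk /= ltnn.
Qed.

Lemma projection_rankS A B : (forall x, A x -> B x) ->
  (projection_rank A <= projection_rank B)%N.
Proof.
move=> sAB; apply/bigmax_leqP => k /asboolP [e eA].
apply: (@leq_bigmax_cond _ _ (fun k : 'I_n.+1 => k : nat)); apply/asboolP.
by exists e; apply: orthogonal_familyS eA.
Qed.

Lemma projection_rank_le A : (projection_rank A <= n)%N.
Proof. by apply/bigmax_leqP => k _; rewrite -ltnS. Qed.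

(** * Maximal families: completeness and minimality of their members *)

Section MaximalFamily.
Variables (A : 'M[C]_n -> Prop) (k : nat) (e : 'I_k -> 'M[C]_n).
Hypotheses (sA : star_algebra A) (eA : maximal_family A e).

Let eP i : projection_in A (e i). Proof. by case: eA => -[/(_ i) []]. Qed.
Let eO i j : i != j -> e i *m e j = 0.
Proof. by case: eA => -[_ h _]; apply: h. Qed.

(** Otherwise the complement of the sum is one more projection orthogonal to the whole family. *)
Lemma maximal_family_sum : \sum_i e i = 1%:M.
Proof.
have [[fA _] nA] := eA.
pose p : 'M[C]_n := 1%:M - \sum_i e i.
have ep i : e i *m p = 0.
  rewrite mulmxBr mulmx1 mulmx_sumr (bigD1 i) //= big1 => [|j nji].
    by have [_ _ ->] := eP i; rewrite addr0 subrr.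
  by apply: eO; rewrite eq_sym.
have hp : p^t* = p.
  rewrite adjmxB adjmx1 adjmx_sum.
  by congr (_ - _); apply: eq_bigr => i _; have [_ -> _] := eP i.
have [/eqP|p0] := eqVneq p 0; first by rewrite subr_eq0 => /eqP.
case: (@orthogonal_family_add A k e p) => //.
  have Ap : A p.
    apply: star_algebraB (star_algebra1 sA) _ => //.
    by apply: star_algebra_sum => // i _; case: (eP i).
  by split=> //; rewrite {1}/p mulmxBl mul1mx mulmx_suml big1 ?subr0.
by move=> e' /nA.
Qed.

(** Otherwise [e i] splits into the nonzero orthogonal projections [p] and [e i - p], which gives a
    family with one more member. *)
Lemma maximal_family_minimal i p :
  projection_in A p -> e i *m p = p -> p = 0 \/ p = e i.
Proof.
move=> [Ap hp pp] ep.
have [->|p0] := eqVneq p 0; [by left|right; apply/esym/eqP].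
rewrite -subr_eq0; apply/negPn/negP => q0.
have [Aei hei eei] := eP i.
have pe : p *m e i = p by rewrite -hp -{1}hei -adjmxM ep.
have pO j : j != i -> e j *m p = 0.
  by move=> nji; rewrite -ep mulmxA eO // mul0mx.
pose e' j := if j == i then p else e j.
have e'A : orthogonal_family A e'.
  split=> [j|j l]; rewrite /e'.
    by case: eqP => // _; split=> //; case: eA => -[/(_ j) []].
  case: (eqVneq j i) => [?|nji]; case: (eqVneq l i) => [?|nli]; subst.
  - by rewrite eqxx.
  - move=> _; apply: projection_orthC => //; last exact: pO.
    by have [] := eP l.
  - by move=> _; apply: pO.
  - exact: eO.
case: (orthogonal_family_add e'A (p := e i - p)) => //.
- split; first exact: star_algebraB.
    by rewrite adjmxB hp hei.
  by rewrite mulmxBl !mulmxBr eei ep pe pp subrr subr0.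
- move=> j; rewrite /e' mulmxBr; have [_|nji] := eqVneq j i.
    by rewrite pe pp subrr.
  by rewrite eO // pO // subr0.
- by move=> e2; case: eA => _; apply.
Qed.

End MaximalFamily.

(** * Polynomial calculus and spectral projections inside the algebra *)

Lemma star_algebra_spectral_poly A (u x : 'M[C]_n) (d : 'rV_n) (q : {poly C}) :
    star_algebra A -> u \in unitmx -> x = invmx u *m diag_mx d *m u -> A x ->
  A (invmx u *m diag_mx (map_mx (horner q) d) *m u).
Proof.
(* The matrix in question is [q] evaluated at [x]; the induction is Horner's scheme. *)
move=> sA uu xE Ax; elim/poly_ind: q => [|q c IH].
  rewrite [map_mx _ _](_ : _ = 0); last by apply/rowP=> j; rewrite !mxE horner0.
  by rewrite linear0 mulmx0 mul0mx; apply: star_algebra0.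
have -> : map_mx (horner (q * 'X + c%:P)) d =
    \row_j ((map_mx (horner q) d) 0 j * d 0 j) + c *: const_mx 1.
  by apply/rowP=> j; rewrite !mxE !hornerE.
rewrite linearD linearZ /= -mulmx_diag diag_const_mx mulmxDr mulmxDl.
apply: star_algebraD => //.
  have := star_algebraM sA IH Ax.
  by rewrite xE !mulmxA mulmxK.
rewrite -scalemxAr -scalemxAl mulmx1 mulVmx //.
by apply: star_algebraZ => //; apply: star_algebra1.
Qed.

(** A nonzero Hermitian matrix has a nonzero eigenvalue [c], and the projection onto its eigenspace
    is a polynomial in [x], hence lies in [A]. *)
Lemma hermitian_spectral_projection A x :
    star_algebra A -> A x -> x^t* = x -> x != 0 ->
  exists p c, [/\ projection_in A p, p != 0, c != 0 & x *m p = c *: p].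
Proof.
move=> sA Ax hx x0.
have nx : x \is normalmx by apply/normalmxP; rewrite hx.
have /orthomx_spectralP := nx.
set u := spectralmx x; set d := spectral_diag x => xE.
have uu : u \in unitmx by apply: spectral_unit.
have iu : invmx u = u^t* by rewrite invmx_unitary // spectral_unitarymx.
have /existsP [i di] : [exists i, d 0 i != 0].
  apply: contraNT x0; rewrite negb_exists => /forallP d0.
  rewrite xE [d](_ : _ = 0) ?linear0 ?mulmx0 ?mul0mx //.
  by apply/rowP => j; rewrite mxE; apply/eqP/negbNE/d0.
pose c := d 0 i.
(* Lagrange interpolation: [q] is 1 at [c] and 0 at the other eigenvalues. Factors repeated for
   multiple eigenvalues do no harm, as each is 1 at [c]. *)
pose q : {poly C} :=
  \prod_(j | d 0 j != c) ((c - d 0 j)^-1 *: ('X - (d 0 j)%:P)).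
pose f : 'rV[C]_n := \row_j (d 0 j == c)%:R.
have qf : map_mx (horner q) d = f.
  apply/rowP => l; rewrite !mxE horner_prod; case: eqP => [->|/eqP nl].
    rewrite big1 // => j nj; rewrite !hornerE mulVf // subr_eq0 eq_sym //.
  by rewrite (bigD1 l) //= !hornerE subrr mulr0 mul0r.
pose p := invmx u *m diag_mx f *m u.
have ff : diag_mx f *m diag_mx f = diag_mx f.
  rewrite mulmx_diag; congr diag_mx; apply/rowP => j; rewrite !mxE.
  by rewrite -natrM mulnb andbb.
exists p, c; split => //.
- split; first by rewrite /p -qf; apply: star_algebra_spectral_poly xE Ax.
    rewrite /p iu !adjmxM trmxCK mulmxA tr_diag_mx map_diag_mx.
    congr (_ *m diag_mx _ *m _); apply/rowP => j; rewrite !mxE.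
    exact: conjC_nat.
  by rewrite /p !mulmxA mulmxK // -[invmx u *m _ *m diag_mx _]mulmxA ff.
- apply/eqP => p0.
  have : diag_mx f = 0.
    have : u *m p *m invmx u = 0 by rewrite p0 mulmx0 mul0mx.
    by rewrite /p !mulmxA mulmxK // mulmxV // mul1mx.
  move=> /(congr1 (fun M : 'M[C]_n => M i i)); rewrite !mxE !eqxx mulr1n.
  by move/eqP; rewrite oner_eq0.
rewrite {1}xE /p !mulmxA mulmxK // -[invmx u *m _ *m diag_mx _]mulmxA mulmx_diag.
rewrite [X in diag_mx X](_ : _ = c *: f) ?linearZ /= -?scalemxAr -?scalemxAl //.
by apply/rowP => j; rewrite !mxE; case: eqP => [->|_]; rewrite ?mulr1 ?mulr0.
Qed.

(** * Corners at minimal projections, and comparison of algebras of equal ranks *)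

Section MinimalProjections.
Variables (A : 'M[C]_n -> Prop) (k : nat) (e : 'I_k -> 'M[C]_n).
Hypotheses (sA : star_algebra A) (eA : maximal_family A e).

Let eP i : projection_in A (e i). Proof. by case: eA => -[/(_ i) []]. Qed.
Let eO i j : i != j -> e i *m e j = 0.
Proof. by case: eA => -[_ h _]; apply: h. Qed.

(** A spectral projection of [x] for a nonzero eigenvalue lies below [e i], so by minimality it is
    [e i]. *)
Lemma corner_hermitian_scalar i x :
  A x -> x^t* = x -> e i *m x = x -> exists c, x = c *: e i.
Proof.
move=> Ax hx ex; have [->|x0] := eqVneq x 0; first by exists 0; rewrite scale0r.
have [p [c [Ap p0 c0 xp]]] := hermitian_spectral_projection sA Ax hx x0.
have ep : e i *m p = p.
  have -> : p = c^-1 *: (x *m p) by rewrite xp scalerA mulVf // scale1r.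
  by rewrite -scalemxAr mulmxA ex.
case: (maximal_family_minimal sA eA Ap ep) => [/eqP|pe].
  by rewrite (negPf p0).
exists c; rewrite -pe -xp pe -{1}hx -{1}ex adjmxM hx.
by have [_ -> _] := eP i.
Qed.

(** The Hermitian case applies to both terms of the decomposition of [x] into its real and imaginary
    parts. *)
Lemma corner_scalar i x : A x -> e i *m x *m e i = x -> exists c, x = c *: e i.
Proof.
move=> Ax ex; have [_ hei eei] := eP i.
have e1 : e i *m x = x by rewrite -{1}ex !mulmxA eei.
have e2 : x *m e i = x by rewrite -{1}ex -!mulmxA eei mulmxA.
have e3 : e i *m x^t* = x^t* by rewrite -{1}hei -adjmxM e2.
have Ax' : A (x^t*) by apply: star_algebraC.
have [|||a aE] := @corner_hermitian_scalar i (x + x^t*).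
- exact: star_algebraD.
- by rewrite adjmxD trmxCK addrC.
- by rewrite mulmxDr e1 e3.
have [|||b bE] := @corner_hermitian_scalar i ('i *: (x - x^t*)).
- by apply: star_algebraZ => //; apply: star_algebraB.
- by rewrite adjmxZ adjmxB trmxCK conjCi scaleNr -scalerN opprB.
- by rewrite -scalemxAr mulmxBr e1 e3.
exists (2^-1 * (a - 'i * b)).
have -> : x = 2^-1 *: ((x + x^t*) - 'i *: ('i *: (x - x^t*))).
  rewrite scalerA -expr2 sqrCi scaleN1r opprK addrACA subrr addr0 -mulr2n.
  by rewrite -scaler_nat scalerA mulVf ?scale1r // pnatr_eq0.
by rewrite aE bE !scalerA -scalerBl scalerA.
Qed.

End MinimalProjections.

(* Since [e] and [f] stay maximal in both algebras, [A] and [B] have the same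
   minimal projections and, up to isomorphism, the same irreducible modules. *)
Lemma star_algebra_rank_eq A B :
    star_algebra A -> star_algebra B -> (forall x, A x -> B x) ->
    projection_rank A = projection_rank B ->
    projection_rank (commutant A) = projection_rank (commutant B) ->
  forall x, B x -> A x.
Proof.
move=> sA sB sAB rAB rAB'.
have sA' := commutant_star_algebra sA; have sB' := commutant_star_algebra sB.
have [e eA] := projection_rank_maximal A.
have [f fB] := projection_rank_maximal (commutant B).
(* With equal ranks, a largest family of the smaller algebra is largest in the bigger one.
   Commutants reverse inclusion, so [f] starts in [commutant B]. *)
have eB : maximal_family B e.
  split; first by case: eA => + _; apply: orthogonal_familyS.
  rewrite rAB; have [e1 [_ nB]] := projection_rank_maximal B; exact: nB.
have fA : maximal_family (commutant A) f.
  split; first by case: fB => + _; apply: orthogonal_familyS; apply: commutantS.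
  by rewrite -rAB'; have [e1 [_ nB]] := projection_rank_maximal (commutant A).
have eP i : projection_in A (e i) by case: eA => -[/(_ i) []].
have eO i j : i != j -> e i *m e j = 0 by case: eA => -[_ h _]; apply: h.
have e0 i : e i != 0 by case: eA => -[/(_ i) []].
have e1 := maximal_family_sum sA eA.
have f1 := maximal_family_sum sB' fB.
(* This is equivalence of the minimal projections [e i] and [e j] in [A]. *)
pose linked i j := `[< exists2 a, A a & e i *m a *m e j != 0 >].
have linkedN i j a : A a -> ~~ linked i j -> e i *m a *m e j = 0.
  by move=> Aa /asboolPn nl; apply/eqP/negPn/negP => a0; apply: nl; exists a.
(* A nonzero [e i *m a *m e j] is a multiple of a partial isometry: its adjoint times itself lies in
   the corner of [e j], where [A] has only scalars. *)
have norm_scalar i j a : A a -> e i *m a *m e j != 0 ->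
    exists2 c, c != 0 & (e i *m a *m e j)^t* *m (e i *m a *m e j) = c *: e j.
  have [Aei hei eei] := eP i; have [Aej hej eej] := eP j => Aa.
  have Ax : A (e i *m a *m e j) by do 2![apply: star_algebraM => //].
  have xej : e i *m a *m e j *m e j = e i *m a *m e j by rewrite -mulmxA eej.
  move: (e i *m a *m e j) Ax xej => x Ax xej x0.
  have [||c cE] := @corner_scalar A _ e sA eA j (x^t* *m x).
  - by apply: star_algebraM => //; apply: star_algebraC.
  - by rewrite -!mulmxA xej mulmxA -{1}hej -adjmxM xej.
  exists c => //; apply: contraNneq x0 => c0.
  by apply/eqP/adjmx_mul_eq0; rewrite cE c0 scale0r.
have linked_trans i j l : linked i j -> linked j l -> linked i l.
  move=> /asboolP[a Aa a0] /asboolP[b Ab b0]; apply/asboolP.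
  have [Aej hej eej] := eP j.
  exists (a *m e j *m b); first by do 2![apply: star_algebraM => //].
  have [c c0 cE] := norm_scalar _ _ _ Aa a0.
  (* The first factor can be cancelled: its adjoint times itself is [c *: e j] with [c] nonzero. *)
  have -> : e i *m (a *m e j *m b) *m e l =
      (e i *m a *m e j) *m (e j *m b *m e l).
    by rewrite -[in LHS]eej !mulmxA.
  apply: contraNneq b0 => ab0.
  have : c *: (e j *m b *m e l) = 0.
    have -> : e j *m b *m e l = e j *m (e j *m b *m e l) by rewrite !mulmxA eej.
    by rewrite scalemxAl -cE -mulmxA ab0 mulmx0.
  by move/eqP; rewrite scaler_eq0 (negPf c0) /= => /eqP->.
have linked_sym i j : linked i j -> linked j i.
  move=> /asboolP[a Aa a0]; apply/asboolP; exists (a^t*).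
    exact: star_algebraC.
  have [_ hei _] := eP i; have [_ hej _] := eP j.
  apply: contraNneq a0 => a0.
  have -> : e i *m a *m e j = (e j *m a^t* *m e i)^t*.
    by rewrite !adjmxM hei hej trmxCK mulmxA.
  by rewrite a0 adjmx0.
have linked_refl i : linked i i.
  apply/asboolP; exists 1%:M; first exact: star_algebra1.
  by rewrite mulmx1; have [_ _ ->] := eP i.
have cutE x : x = \sum_i \sum_j e i *m x *m e j.
  rewrite -[LHS]mul1mx -[LHS]mulmx1 -e1 !mulmx_suml; apply: eq_bigr => i _.
  by rewrite mulmx_sumr.
(* [z j] is central in [A]. Each [f t] is minimal in the commutant of [A], so
   [z j] is a sum of some of the [f t] and commutes with [B] as well. *)
pose z j := \sum_(i | linked i j) e i.
have zA j : A (z j).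
  by apply: star_algebra_sum => // i _; case: (eP i).
have ez i j : e i *m z j = if linked i j then e i else 0.
  rewrite /z mulmx_sumr; case: ifP => lij.
    rewrite (bigD1 i) //= big1 => [|l /andP[_ nl]]; last by apply: eO; rewrite eq_sym.
    by have [_ _ ->] := eP i; rewrite addr0.
  by rewrite big1 // => l ll; apply: eO; apply: contraFneq lij => ->.
have ze i j : z j *m e i = if linked i j then e i else 0.
  rewrite /z mulmx_suml; case: ifP => lij.
    rewrite (bigD1 i) //= big1 => [|l /andP[_ nl]]; last exact: eO.
    by have [_ _ ->] := eP i; rewrite addr0.
  by rewrite big1 // => l ll; apply: eO; apply: contraFneq lij => <-.
have zC j : commutant A (z j).
  move=> a Aa; rewrite (cutE a) mulmx_sumr mulmx_suml; apply: eq_bigr => i _.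
  rewrite mulmx_sumr mulmx_suml; apply: eq_bigr => l _.
  rewrite !mulmxA ze -[RHS]mulmxA ez.
  have [lil|nil] := boolP (linked i l); last first.
    have al := linkedN i l a Aa nil.
    by case: ifP => _; case: ifP => _; rewrite ?mul0mx ?mulmx0 ?al.
  have -> : linked l j = linked i j.
    by apply/idP/idP; apply: linked_trans => //; apply: linked_sym.
  by case: ifP; rewrite ?mul0mx ?mulmx0.
have zh j : (z j)^t* = z j.
  rewrite adjmx_sum; apply: eq_bigr => i _.
  by have [_ -> _] := eP i.
have zz j : z j *m z j = z j.
  rewrite {1}/z mulmx_suml; apply: eq_bigr => i lij; rewrite ez lij //.
have zB j : commutant B (z j).
  rewrite -[z j]mul1mx -f1 mulmx_suml.
  apply: (@star_algebra_sum (commutant B)) => // t _.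
  have [[/(_ t) [[ft hft fft] _] _] _] := fB.
  have [[/(_ t) [[ft' _ _] _] _] _] := fA.
  have fz : f t *m z j = z j *m f t by apply: ft'.
  have [|||] := @maximal_family_minimal _ _ f sA' fA t (f t *m z j).
  - split; first by apply: (star_algebraM sA') => //; apply: zC.
      by rewrite adjmxM hft zh fz.
    by rewrite [in X in X *m _]fz mulmxA -[z j *m _ *m _]mulmxA fft -fz -mulmxA zz.
  - by rewrite mulmxA fft.
  - by move=> ->; apply: (star_algebra0 sB').
  - by move=> ->.
move=> b Bb; rewrite (cutE b).
apply: star_algebra_sum => // i _; apply: star_algebra_sum => // j _.
have [Aei hei eei] := eP i; have [Aej hej eej] := eP j.
have [/asboolP[a Aa a0]|nij] := boolP (linked i j); last first.
  (* In the unlinked case [z j] can be moved from [e j] across [b] to [e i], which it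
     annihilates. *)
  have zej : z j *m e j = e j by rewrite ze linked_refl.
  rewrite -zej mulmxA -[e i *m b *m _]mulmxA -(zB j b Bb) mulmxA ez (negPf nij).
  by rewrite !mul0mx; apply: star_algebra0.
have [c c0 cE] := norm_scalar _ _ _ Aa a0.
have Ax : A (e i *m a *m e j) by do 2![apply: star_algebraM => //].
have eix : e i *m (e i *m a *m e j) = e i *m a *m e j by rewrite !mulmxA eei.
move: (e i *m a *m e j) Ax eix cE {a0} => x Ax eix cE.
(* Multiplying by [x^t*] moves the block of [b] into the corner of [e i], where [B] too has only
   scalars. Multiplying back by [x] shows the block to be a multiple of [x], which is in [A]. *)
have [||d dE] := @corner_scalar B _ e sB eB i (e i *m b *m e j *m x^t*).
- apply: (star_algebraM sB); last exact: (sAB _ (star_algebraC sA Ax)).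
  apply: (star_algebraM sB); last exact: sAB.
  by apply: (star_algebraM sB) => //; apply: sAB.
- by rewrite !mulmxA eei -[in LHS]mulmxA -{2}hei -adjmxM eix.
have -> : e i *m b *m e j = (c^-1 * d) *: x.
  rewrite -scalerA [d *: x](_ : _ = c *: (e i *m b *m e j)).
    by rewrite scalerA mulVf // scale1r.
  by rewrite -eix scalemxAl -dE -mulmxA cE -scalemxAr -!mulmxA eej.
exact: star_algebraZ.
Qed.

(** * Length of strict chains of star-algebras *)

Lemma star_algebra_chain (A : nat -> 'M[C]_n -> Prop) :
    (0 < n)%N -> (forall i, star_algebra (A i)) ->
    (forall i x, A i x -> A i.+1 x) ->
  exists2 i, (i < 2 * n)%N & forall x, A i.+1 x -> A i x.
Proof.
move=> n0 sA AS; apply: contrapT => nex.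
pose phi i := (projection_rank (A i) + (n - projection_rank (commutant (A i))))%N.
have phiS i : (i < 2 * n)%N -> (phi i < phi i.+1)%N.
  move=> lti; rewrite ltnNge; apply/negP => le_phi; apply: nex; exists i => //.
  have r1 := projection_rankS (AS i).
  have r2 := projection_rankS (commutantS (AS i)).
  have := projection_rank_le (commutant (A i)).
  rewrite /phi in le_phi => r3.
  by apply: star_algebra_rank_eq => //; [exact: AS | lia | lia].
(* As [n] is positive, the identity alone is a family, so [phi] starts at 1 or more. After [2 * n]
   strict steps it would exceed its upper bound [2 * n]. *)
have phi_ge i : (i <= 2 * n)%N -> (i < phi i)%N.
  elim: i => [_|i IH lti]; last by apply: leq_ltn_trans (IH (ltnW lti)) (phiS _ lti).
  rewrite ltn_addr // (leq_trans _ (@leq_bigmax_cond _ _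
    (fun k : 'I_n.+1 => k : nat) (Ordinal (n0 : 1 < n.+1)%N) _)) //.
  apply/asboolP; exists (fun _ => 1%:M); split=> [i|i j]; last by rewrite !ord1.
  split; last first.
    apply/eqP => /(congr1 (fun M : 'M[C]_n => M (Ordinal n0) (Ordinal n0))) /eqP.
    by rewrite !mxE eqxx oner_eq0.
  by split; rewrite ?adjmx1 ?mulmx1 //; apply: star_algebra1.
have := phi_ge _ (leqnn _).
have := projection_rank_le (A (2 * n)%N).
rewrite /phi; lia.
Qed.

End StarAlgebras.

(** * Products of color matrices as sums over walks, and the walk algebra *)

Lemma sum_tuple_cons (R : nmodType) (T : finType) k (F : k.+1.-tuple T -> R) :
  \sum_w F w = \sum_x \sum_(w : k.-tuple T) F [tuple of x :: w].
Proof.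
rewrite pair_big /= (reindex (fun p : T * k.-tuple T => [tuple of p.1 :: p.2])) //.
exists (fun w => (thead w, [tuple of behead w])) => [[x w] _|w _] /=.
  by congr (_, _); apply: val_inj.
by rewrite -tuple_eta.
Qed.

Section WalkAlgebra.
Variables (C : numClosedFieldType) (n : nat).
Implicit Types (chi : coloring 'I_n) (M : 'M[C]_n).

Definition respects chi M :=
  forall u v u' v', chi u v = chi u' v' -> M u v = M u' v'.

Definition color_mx chi (f : color chi -> C) : 'M[C]_n :=
  \matrix_(u, v) f (chi u v).

Definition word_mx chi (fs : seq (color chi -> C)) : 'M[C]_n :=
  foldr (fun f M => color_mx f *m M) 1%:M fs.

(* Words of length at least 2 suffice when [chi] separates loops, because the
   identity is then a color matrix. *)
Inductive walk_algebra chi : 'M[C]_n -> Prop :=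
| walk_algebra_word (fs : seq (color chi -> C)) :
    (1 < size fs)%N -> walk_algebra chi (word_mx fs)
| walk_algebra0 : walk_algebra chi 0
| walk_algebraD M N :
    walk_algebra chi M -> walk_algebra chi N -> walk_algebra chi (M + N)
| walk_algebraZ c M : walk_algebra chi M -> walk_algebra chi (c *: M).

Lemma respects_color_mx chi M :
  respects chi M -> exists f : color chi -> C, color_mx f = M.
Proof.
move=> chiM.
(* The value at a color is read off at any pair of that color; the default 0 is taken only at colors
   that do not occur. *)
exists (fun c => if [pick p : 'I_n * 'I_n | chi p.1 p.2 == c] is Some p
                 then M p.1 p.2 else 0).
apply/matrixP => u v; rewrite mxE; case: pickP => [p /eqP/chiM //|].
by move=> /(_ (u, v)); rewrite /= eqxx.
Qed.

Lemma color_mx1 chi :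
  separates_loops chi -> exists f : color chi -> C, color_mx f = 1%:M.
Proof.
move=> sep; apply: respects_color_mx => u v u' v'; rewrite !mxE.
have [->|uv] := eqVneq u v; have [->|uv'] := eqVneq u' v' => //.
  by move/sep; case; apply/eqP.
by move/esym/sep; case; apply/eqP.
Qed.

Lemma color_mx_adj chi (f : color chi -> C) : respects_converse chi ->
  exists g : color chi -> C, color_mx g = (color_mx f)^t*.
Proof.
move=> conv; apply: respects_color_mx => u v u' v' /conv e.
by rewrite !mxE e.
Qed.

Lemma word_mx_cat chi (fs gs : seq (color chi -> C)) :
  word_mx (fs ++ gs) = word_mx fs *m word_mx gs.
Proof. by elim: fs => [|f fs IH] /=; rewrite ?mul1mx // IH mulmxA. Qed.

(** The adjoint reverses the word and replaces each letter by its adjoint, again a color matrix. *)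
Lemma word_mx_adj chi (fs : seq (color chi -> C)) : respects_converse chi ->
  exists2 gs : seq (color chi -> C),
    size gs = size fs & word_mx gs = (word_mx fs)^t*.
Proof.
move=> conv; elim: fs => [|f fs [gs sz gsE]]; first by exists [::]; rewrite //= adjmx1.
have [g gE] := color_mx_adj f conv.
exists (gs ++ [:: g]); first by rewrite size_cat addn1 sz.
by rewrite word_mx_cat /= mulmx1 gsE gE adjmxM.
Qed.

Lemma walk_algebra_mx chi M :
  separates_loops chi -> respects chi M -> walk_algebra chi M.
Proof.
move=> sep /respects_color_mx [f <-]; have [g g1] := color_mx1 sep.
rewrite -[color_mx f](_ : word_mx [:: f; g] = _); first exact: walk_algebra_word.
by rewrite /= g1 !mulmx1.
Qed.

Lemma walk_algebra_star chi : separates_loops chi -> respects_converse chi ->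
  star_algebra (walk_algebra chi).
Proof.
move=> sep conv; split.
- have [f f1] := color_mx1 sep; apply: walk_algebra_mx => //.
  by rewrite -f1 => u v u' v' e; rewrite !mxE e.
- exact: walk_algebraD.
- exact: walk_algebraZ.
- move=> M N AM AN; elim: M / AM => [fs fs1||M M' _ IH _ IH'|c M _ IH].
  + elim: N / AN => [gs gs1||N N' _ IH _ IH'|c N _ IH].
    * rewrite -word_mx_cat; apply: walk_algebra_word; rewrite size_cat.
      exact: ltn_addr.
    * by rewrite mulmx0; apply: walk_algebra0.
    * by rewrite mulmxDr; apply: walk_algebraD.
    * by rewrite -scalemxAr; apply: walk_algebraZ.
  + by rewrite mul0mx; apply: walk_algebra0.
  + by rewrite mulmxDl; apply: walk_algebraD.
  + by rewrite -scalemxAl; apply: walk_algebraZ.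
- move=> M; elim=> {M} [fs fs1||M M' _ IH _ IH'|c M _ IH].
  + have [gs sz <-] := word_mx_adj fs conv.
    by apply: walk_algebra_word; rewrite sz.
  + by rewrite adjmx0; apply: walk_algebra0.
  + by rewrite adjmxD; apply: walk_algebraD.
  + by rewrite adjmxZ; apply: walk_algebraZ.
Qed.

Lemma word_mxE chi (fs : seq (color chi -> C)) k u v : size fs = k.+1 ->
  word_mx fs u v = \sum_(w : k.-tuple 'I_n)
    \prod_(p <- zip fs (walk_colors chi u w v)) p.1 p.2.
Proof.
elim: k fs u => [|k IH] [|f fs] u //= [] sz.
  move/size0nil: sz => ->; rewrite (big_pred1 [tuple]) => [|w].
    by rewrite /= mulmx1 mxE big_seq1.
  by apply/esym/eqP; apply: tuple0.
rewrite sum_tuple_cons mxE; apply: eq_bigr => x _.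
rewrite (IH _ _ sz) mxE mulr_sumr; apply: eq_bigr => w _.
by rewrite /= big_cons.
Qed.

Lemma size_walk_colors chi u w v : size (walk_colors chi u w v) = (size w).+1.
Proof. by rewrite size_pairmap size_rcons. Qed.

Lemma prod_indicator (T : eqType) (cs ds : seq T) : size ds = size cs ->
  \prod_(p <- zip [seq (fun d => (d == c)%:R) | c <- cs] ds) p.1 p.2
    = (ds == cs)%:R :> C.
Proof.
elim: cs ds => [|c cs IH] [|d ds] //= => [_|[sz]]; first by rewrite big_nil.
by rewrite big_cons IH // -natrM mulnb eqseq_cons.
Qed.

(** A multiset of color words determines every sum over it of products of functions of the letters.
    Conversely, indicator functions as letters recover the multiplicities. *)
Lemma kwalk_refinementP chi k u v u' v' :
  kwalk_refinement k.+1 chi u v = kwalk_refinement k.+1 chi u' v' <->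
  forall fs : seq (color chi -> C),
    size fs = k.+1 -> word_mx fs u v = word_mx fs u' v'.
Proof.
split=> [/eq_seq_msetP e fs sz|e].
  have wordE a b : word_mx fs a b =
      \sum_(cs <- [seq walk_colors chi a (val w) b | w <- enum {: k.-tuple 'I_n}])
        \prod_(p <- zip fs cs) p.1 p.2.
    by rewrite (word_mxE _ _ sz) big_map big_enum.
  by rewrite !wordE; apply: perm_big.
apply/msetP => cs; rewrite !mset_seqE.
have [szcs|szcs] := eqVneq (size cs) k.+1; last first.
  rewrite !count_map !(eq_count (a2 := pred0)) // => w /=;
    by apply: contraNF szcs => /eqP <-; rewrite size_walk_colors size_tuple.
have countE a b : (count_mem cs
      [seq walk_colors chi a (val w) b | w <- enum {: k.-tuple 'I_n}])%:R =
    word_mx [seq (fun d => (d == c)%:R : C) | c <- cs] a b.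
  rewrite count_map.
  rewrite (@word_mxE _ _ k) ?size_map // -sum1_count natr_sum big_mkcond big_enum /=.
  apply: eq_bigr => w _; rewrite prod_indicator ?size_walk_colors ?size_tuple //.
  by case: eqP.
(* Multiplicities can be compared in [C], which has characteristic 0. *)
apply/eqP; rewrite -(eqr_nat C); apply/eqP; apply: etrans (countE u v) _.
by rewrite e ?size_map // -countE.
Qed.

End WalkAlgebra.

(** * Existence of a finest walk length *)

Section WalkLength.
Variable n : nat.
Implicit Types chi : coloring 'I_n.

(** Appending the identity, a color matrix, lengthens a word without changing its product. *)
Lemma kwalk_finer chi j k : separates_loops chi -> (0 < j <= k)%N ->
  finer (kwalk_refinement k chi) (kwalk_refinement j chi).
Proof.
move=> sep /andP[j0]; elim: k => [|k IH]; first by case: j j0.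
rewrite leq_eqVlt => /predU1P[-> //|]; rewrite ltnS => jk.
have k0 := leq_trans j0 jk; move=> u v u' v' e; apply: IH => //.
case: k k0 e {jk} => // k _ /(kwalk_refinementP algC) e.
have [f f1] := color_mx1 algC sep.
apply/(kwalk_refinementP algC) => fs sz.
have := e (fs ++ [:: f]); rewrite word_mx_cat /= f1 !mulmx1; apply.
by rewrite size_cat sz addn1.
Qed.

(** The sets [E k] of identified pairs shrink as [k] grows, so a [k] with the smallest [E k] is
    finest. *)
Lemma walk_length_finest chi :
  separates_loops chi -> finest_length chi (walk_length chi).
Proof.
move=> sep.
pose E k := [set p : ('I_n * 'I_n) * ('I_n * 'I_n) |
  kwalk_refinement k chi p.1.1 p.1.2 == kwalk_refinement k chi p.2.1 p.2.2].
have ES j k : (0 < j <= k)%N -> E k \subset E j.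
  move=> jk; apply/subsetP => p; rewrite !inE => /eqP e; apply/eqP.
  exact: kwalk_finer e.
have exk : exists k, finest_length chi k.
  have exc : exists c, `[< exists2 k, (2 <= k)%N & #|E k| = c >].
    by exists #|E 2|; apply/asboolP; exists 2.
  case: (ex_minnP exc) => c /asboolP [k k2 <-] minc.
  exists k; split=> // j j2; have [jk|/ltnW kj] := leqP j k.
    by apply: kwalk_finer => //; rewrite jk ltnW.
  have k0 : (0 < k <= j)%N by rewrite (ltnW k2).
  have EE : E j = E k.
    apply/eqP; rewrite eqEcard; apply/andP; split; first exact: ES.
    by apply: minc; apply/asboolP; exists j.
  move=> u v u' v' /eqP e.
  have : ((u, v), (u', v')) \in E k by rewrite in_set.
  by rewrite -EE in_set => /eqP.
have exk' : exists k, `[< finest_length chi k >].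
  by have [k ?] := exk; exists k; apply/asboolP.
case: (ex_minnP exk') => k /asboolP kf mink.
rewrite /walk_length; case: classical_sets.xgetP => [l _ [] //|/(_ k) []].
split=> // j jf.
by apply: mink; apply/asboolP.
Qed.

End WalkLength.

(** * Walk refinement expressed through the walk algebra *)

Section WalkRefinement.
Variable n : nat.
Implicit Types (chi : coloring 'I_n) (M : 'M[algC]_n).

(** Since the chosen length is finest, agreement on words of that length implies agreement on all
    words of length at least 2, hence on their span. *)
Lemma walk_refinementP chi u v u' v' : separates_loops chi ->
  walk_refinement chi u v = walk_refinement chi u' v' <->
  forall M, walk_algebra chi M -> M u v = M u' v'.
Proof.
move=> sep; have [k2 kfin] := walk_length_finest sep; split=> [e M|e].
  elim=> {M} [fs|//|M N _ IH _ IH'|c M _ IH]; rewrite ?mxE ?IH ?IH' //.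
  case: fs => [//|f fs] sz; have := kfin _ sz _ _ _ _ e.
  by move/(kwalk_refinementP algC); apply.
rewrite /walk_refinement; case: (walk_length chi) k2 => // k k2.
apply/(kwalk_refinementP algC) => fs sz; apply: e.
by apply: walk_algebra_word; rewrite sz.
Qed.

Lemma walk_refinement_respects chi M :
  separates_loops chi -> walk_algebra chi M -> respects (walk_refinement chi) M.
Proof. by move=> sep AM u v u' v' /(walk_refinementP _ _ _ _ sep); apply. Qed.

Lemma walk_refinement_separates chi :
  separates_loops chi -> separates_loops (walk_refinement chi).
Proof.
move=> sep u v w vw /(walk_refinementP _ _ _ _ sep) /(_ 1%:M).
rewrite !mxE eqxx (introF eqP vw) => /(_ _)/eqP; rewrite oner_eq0 => H.
suff : false by []; apply: H; apply: walk_algebra_mx => //.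
have [f <-] := color_mx1 algC sep.
by move=> a b a' b' e; rewrite !mxE e.
Qed.

Lemma walk_refinement_converse chi : separates_loops chi ->
  respects_converse chi -> respects_converse (walk_refinement chi).
Proof.
move=> sep conv u v u' v' /(walk_refinementP _ _ _ _ sep) e.
apply/(walk_refinementP _ _ _ _ sep) => M AM.
have := e _ (star_algebraC (walk_algebra_star algC sep conv) AM).
by rewrite !mxE => /(can_inj (@conjCK _)).
Qed.

Lemma walk_refinement_iter_invariant chi m :
    separates_loops chi -> respects_converse chi ->
  separates_loops (walk_refinement_iter m chi) /\
  respects_converse (walk_refinement_iter m chi).
Proof.
move=> sep conv; elim: m => [//|m [sepm convm]].
split; first exact: walk_refinement_separates.
exact: walk_refinement_converse.
Qed.

(** The algebra of one coloring determines the next coloring, so equal algebras at [m] and [m.+1]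
    give equal partitions at [m.+1] and [m.+2]. *)
Lemma stable_atS chi m :
    separates_loops chi -> respects_converse chi ->
    (forall M, walk_algebra (walk_refinement_iter m.+1 chi) M ->
               walk_algebra (walk_refinement_iter m chi) M) ->
  stable_at chi m.+1.
Proof.
move=> sep conv sub.
have [sepm _] := walk_refinement_iter_invariant m sep conv.
have [sepm1 _] := walk_refinement_iter_invariant m.+1 sep conv.
split=> u v u' v' e.
  apply: (proj2 (walk_refinementP u v u' v' sepm1)) => M /sub.
  exact: (proj1 (walk_refinementP u v u' v' sepm) e).
apply: (proj2 (walk_refinementP u v u' v' sepm)) => M AM.
apply: (proj1 (walk_refinementP u v u' v' sepm1) e).
by apply: walk_algebra_mx => //; apply: walk_refinement_respects.
Qed.

End WalkRefinement.

(** * The bound on the number of iterations *)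

Lemma stable_at_bound n (chi : coloring 'I_n) :
    separates_loops chi -> respects_converse chi ->
  exists2 m, (m <= 2 * n)%N & stable_at chi m.
Proof.
move=> sep conv.
have [n0|n0] := posnP n.
  by exists 0%N => //; split=> u; suff: false by []; case: u; rewrite n0.
pose A i (M : 'M[algC]_n) := walk_algebra (walk_refinement_iter i chi) M.
have inv i := walk_refinement_iter_invariant i sep conv.
have [||i lti sub] := star_algebra_chain (A := A) n0.
- by move=> i; have [sepi convi] := inv i; apply: walk_algebra_star.
(* The chain increases because a matrix of one algebra is constant on the color classes of the next
   coloring. *)
- move=> i M AM; have [sepi _] := inv i; have [sepi1 _] := inv i.+1.
  by apply: walk_algebra_mx => //; apply: walk_refinement_respects.
by exists i.+1 => //; apply: stable_atS sub.
Qed.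

Local Close Scope sesquilinear_scope.
Local Close Scope ring_scope.

Theorem theorem11 (n : nat) (C : choiceType) (chi : 'I_n -> 'I_n -> C)
    (hloop : separates_loops (Coloring chi))
    (hconv : respects_converse (Coloring chi)) :
  exists m : nat,
    stable_at (Coloring chi) m /\
    (forall j : nat, stable_at (Coloring chi) j -> m <= j) /\
    m <= 2 * n.
Proof.
have [k le_k stk] := stable_at_bound hloop hconv.
have exk : exists k, `[< stable_at (Coloring chi) k >].
  by exists k; apply/asboolP.
case: (ex_minnP exk) => m /asboolP stm minm.
exists m; split=> //; split=> [j stj|].
  by apply: minm; apply/asboolP.
by apply: leq_trans le_k; apply: minm; apply/asboolP.
Qed.
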